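(* For every rational number $p/q$ with $9/10 \le p/q < 1$, there exist infinitely many cyclically $4$-connected cubic graphs $G$ of girth $5$ such that $m_3(G) = p/q$.
   Context: For a bridgeless cubic graph $G$, $m_3(G)$ denotes the maximum, over all choices of three perfect matchings $M_1, M_2, M_3$ of $G$, of $|M_1\cup M_2\cup M_3|$, divided by $|E(G)|$. A graph is cyclically $k$-connected if no set of fewer than $k$ edges is cycle-separating, i.e. its removal never leaves two components each containing a cycle. *)

(* Defs.v *)
From HB Require Import structures.
From mathcomp Require Import all_boot all_order all_algebra.
Set Implicit Arguments. Unset Strict Implicit. Unset Printing Implicit Defensive.
Import Order.TTheory GRing.Theory Num.Theory.

Section Graphs.
Variable T : finType.
Variable e : rel T.

Definition simple_graph : Prop := symmetric e /\ irreflexive e.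

Definition edges : {set {set T}} :=
  [set [set x; y] | x in T, y in T & e x y].

Definition cubic : Prop := forall v : T, #|[set u | e v u]| = 3.

Definition perfect_matching (M : {set {set T}}) : bool :=
  (M \subset edges) && [forall v, #|[set f in M | v \in f]| == 1].

Definition m3 : rat :=
  (\max_(M1 : {set {set T}} | perfect_matching M1)
    \max_(M2 : {set {set T}} | perfect_matching M2)
     \max_(M3 : {set {set T}} | perfect_matching M3)
       #|M1 :|: M2 :|: M3|)%:R / (#|edges|)%:R.

Definition is_cycle (r : rel T) (s : seq T) : bool :=
  [&& uniq s, 3 <= size s & path.cycle r s].

Definition girth_eq (g : nat) : Prop :=
  (exists s, is_cycle e s /\ size s = g) /\
  (forall s, is_cycle e s -> g <= size s).

Definition del_edges (F : {set {set T}}) : rel T :=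
  fun x y => e x y && ([set x; y] \notin F).

Definition cycle_separating (F : {set {set T}}) : Prop :=
  exists s1 s2 : seq T, exists x1 x2 : T,
    [/\ is_cycle (del_edges F) s1, is_cycle (del_edges F) s2,
        x1 \in s1, x2 \in s2 & ~~ connect (del_edges F) x1 x2].

Definition cyclically_k_connected (k : nat) : Prop :=
  forall F : {set {set T}}, F \subset edges -> #|F| < k ->
    ~ cycle_separating F.

End Graphs.

(* Main.v *)
Require Import Defs.
From mathcomp Require Import all_boot all_order all_algebra.
From mathcomp Require Import zify ring lra.
Set Implicit Arguments. Unset Strict Implicit. Unset Printing Implicit Defensive.
Import Order.TTheory GRing.Theory Num.Theory.

(** The graphs are rings of [m] blocks of 18 vertices, consecutive blocks being
joined by two edges. A block is the Petersen graph minus two adjacent vertices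
([P8]), joined by two edges to the Petersen graph minus two disjoint edges
([P10]). Call the state of a pair of joining edges "distinct" if three given
perfect matchings cover the two edges exactly once each, by different matchings.
In a 3-edge-colouring [P10] has distinct states on both sides, while 
[P8], with its dangling edges grouped by the deleted vertex they came from
(type [true]), never has a distinct state; so blocks of type [true] cannot be
covered. Quantitatively, the number of edges owned by the block and missed by the
three matchings is at least [3 + [left distinct] - [right distinct]], which
telescopes around the ring. Grouping the dangling edges of [P8] in the other
way (type [false]) gives a coverable block with the corresponding bound
[[left distinct] - [right distinct]]. With [k] blocks of type [true] exactly [3k]
of the [27m] edges are missed, so [m3 = 1 - k / 9m].

A nontrivial vertex subset of a block has at least two boundary edges inside the
block, so an edge cut of size at most 3 splits at most one block, and [P8] and [P10]
allow it to cut off at most one vertex. *)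

(** * Graphs given by an incidence structure *)

Section IncidenceGraph.
Variables (V I : finType) (s d : I -> V).

Definition ends (i : I) : {set V} := [set s i; d i].

Definition inc_graph : rel V := fun x y => [exists i, ends i == [set x; y]].

Definition incident (v : V) (i : I) : nat := (v == s i) + (v == d i).

Definition cut_size (X : pred V) : nat := \sum_i (X (s i) != X (d i)).

(** Matchings are encoded as predicates on edge indices, which turns covering conditions into sums
    of naturals. *)
Definition matching_bits (mu : I -> bool) : Prop :=
  forall v, \sum_i mu i * incident v i = 1.

Definition uncovered (mu1 mu2 mu3 : I -> bool) : nat :=
  \sum_i ~~ [|| mu1 i, mu2 i | mu3 i].

Hypothesis loopless : forall i, s i != d i.
Hypothesis ends_inj : injective ends.

Let e := inc_graph.

Lemma inc_graph_sym : symmetric e.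
Proof. by move=> x y; apply: eq_existsb => i; rewrite (setUC [set x]). Qed.

Lemma inc_graph_irr : irreflexive e.
Proof.
move=> x; apply/negbTE/existsPn => i; apply/eqP => /(congr1 (fun A : {set V} => #|A|)).
by rewrite setUid cards1 cards2 loopless.
Qed.

Lemma inc_graph_ends i : e (s i) (d i).
Proof. by apply/existsP; exists i. Qed.

Lemma incidentE v i : incident v i = (v \in ends i).
Proof.
rewrite /incident !inE; case: eqP => [->|_]; last by [].
by rewrite (negbTE (loopless i)).
Qed.

Lemma edges_ends : edges e = [set ends i | i : I].
Proof.
apply/setP => f; apply/imset2P/imsetP => [[x y _]|[i _ ->]].
  by rewrite inE => /existsP [i /eqP <-] ->; exists i.
by exists (s i) (d i) => //; rewrite inE inc_graph_ends.
Qed.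

Lemma card_edges : #|edges e| = #|I|.
Proof. by rewrite edges_ends card_imset. Qed.

Lemma card_edges_at (A : {set {set V}}) v : A \subset edges e ->
  #|[set f in A | v \in f]| = \sum_i (ends i \in A) * incident v i.
Proof.
move=> sA; have -> : [set f in A | v \in f] =
    ends @: [set i | (ends i \in A) && (v \in ends i)].
  apply/setP => f; apply/idP/imsetP => [|[i + ->]]; last by rewrite !inE.
  rewrite inE => /andP [fA vf]; have := subsetP sA _ fA.
  by rewrite edges_ends => /imsetP [i _ fE]; exists i; rewrite // inE -fE fA.
rewrite card_imset // -sum1_card big_mkcond /=.
by apply: eq_bigr => i _; rewrite inE incidentE mulnb; case: ifP.
Qed.

Lemma inc_graph_cubic :
  (forall v, \sum_i incident v i = 3) -> cubic e.
Proof.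
move=> deg v; rewrite -(deg v).
have -> : \sum_i incident v i = \sum_i (ends i \in edges e) * incident v i.
  by apply: eq_bigr => i _; rewrite edges_ends imset_f // mul1n.
rewrite -card_edges_at //.
have -> : [set f in edges e | v \in f] = [set [set v; u] | u in [set u | e v u]].
  apply/setP => f; apply/idP/imsetP => [|[u]]; last first.
    rewrite inE => evu ->; rewrite !inE eqxx /= andbT.
    by apply/imset2P; exists v u => //; rewrite inE.
  rewrite inE => /andP [/imset2P [x y _]]; rewrite inE => exy ->.
  rewrite !inE => /orP [] /eqP ->; first by exists y; rewrite ?inE.
  by exists x; rewrite ?inE 1?inc_graph_sym // setUC.
rewrite card_in_imset // => x y; rewrite !inE => evx evy /setP /(_ x).
rewrite !inE eqxx orbT => /esym /orP [/eqP xv|/eqP //].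
by move: evx; rewrite xv [e _ _]inc_graph_irr.
Qed.

(** All edges leaving the component of [x1] after deletion of [F] lie in [F], so this component is
    one side of a cut of size at most 3. The hypothesis leaves at most one vertex on some side, too
    few for the cycle it contains. *)
Lemma inc_graph_cyclically_4_connected :
  (forall X : pred V, cut_size X <= 3 ->
     (exists a, forall v, X v -> v = a) \/ (exists a, forall v, ~~ X v -> v = a)) ->
  cyclically_k_connected e 4.
Proof.
move=> cutP F _ cardF [s1 [s2 [x1 [x2 [c1 c2 x1s x2s ncon]]]]].
pose X := connect (del_edges e F) x1.
have dsym : symmetric (del_edges e F).
  by move=> x y; rewrite /del_edges inc_graph_sym setUC.
have csym : connect_sym (del_edges e F) := sym_connect_sym dsym.
have two r (c : seq V) : is_cycle r c -> exists a b, [/\ a != b, a \in c & b \in c].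
  case: c => [|a [|b c]] /and3P [] //= /andP [+ _] _ _; rewrite inE negb_or => /andP [ab _].
  by exists a, b; rewrite !inE !eqxx orbT.
have {}cutP := cutP X; case: cutP.
- apply: leq_trans (_ : #|F| <= 3) => //; rewrite /cut_size.
  have -> : \sum_i (X (s i) != X (d i)) = #|[set i | X (s i) != X (d i)]|.
    by rewrite -sum1_card [RHS]big_mkcond; apply: eq_bigr => i _; rewrite inE; case: ifP.
  rewrite -(card_imset _ ends_inj) subset_leq_card //.
  apply/subsetP => _ /imsetP [i + ->]; rewrite inE; apply: contraR => iF.
  have ed : del_edges e F (s i) (d i) by rewrite /del_edges inc_graph_ends.
  by apply/eqP/(same_connect_r csym)/connect1.
- case=> a aP; have [x [y [xy xs ys]]] := two _ _ c1.
  have /and3P [_ _ cy] := c1.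
  have xX := connect_cycle cy x1s xs; have yX := connect_cycle cy x1s ys.
  by move/eqP: xy; apply; rewrite (aP x) // (aP y).
case=> a aP; have [x [y [xy xs ys]]] := two _ _ c2.
have /and3P [_ _ cy] := c2.
have nX z : z \in s2 -> ~~ X z.
  move=> zs; apply: contra ncon => x1z.
  exact: connect_trans x1z (connect_cycle cy zs x2s).
by move/eqP: xy; apply; rewrite (aP x) ?nX // (aP y) ?nX.
Qed.

Lemma perfect_matching_bits M : perfect_matching e M ->
  matching_bits (fun i => ends i \in M).
Proof.
case/andP => sM /forallP Mv v; rewrite -card_edges_at //; exact/eqP/Mv.
Qed.

Lemma matching_bitsP mu : matching_bits mu ->
  perfect_matching e [set ends i | i in [pred i | mu i]].
Proof.
move=> muP; have sM : [set ends i | i in [pred i | mu i]] \subset edges e.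
  by apply/subsetP => _ /imsetP [i _ ->]; rewrite edges_ends imset_f.
rewrite /perfect_matching sM; apply/forallP => v; rewrite card_edges_at // -(muP v).
by apply/eqP/eq_bigr => i _; rewrite mem_imset.
Qed.

Lemma card_covered (M1 M2 M3 : {set {set V}}) :
  M1 \subset edges e -> M2 \subset edges e -> M3 \subset edges e ->
  #|M1 :|: M2 :|: M3| +
    uncovered (fun i => ends i \in M1) (fun i => ends i \in M2)
              (fun i => ends i \in M3) = #|I|.
Proof.
move=> s1 s2 s3; have -> : M1 :|: M2 :|: M3 =
   ends @: [set i | [|| ends i \in M1, ends i \in M2 | ends i \in M3]].
  apply/setP => f; apply/idP/imsetP => [fM|[i + ->]]; last by rewrite !inE orbA.
  have : f \in edges e.
    by move: fM; rewrite !inE => /orP [/orP []|]; apply: subsetP.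
  rewrite edges_ends => /imsetP [i _ fE]; exists i => //.
  by move: fM; rewrite !inE fE orbA.
rewrite card_imset // /uncovered -sum1_card big_mkcond -big_split /=.
rewrite -sum1_card; apply: eq_bigr => i _; rewrite inE; by case: ifP.
Qed.

(** Covering the most edges amounts to missing the fewest, and [D] is that minimum. *)
Lemma inc_graph_m3 D :
  (forall mu1 mu2 mu3, matching_bits mu1 -> matching_bits mu2 ->
     matching_bits mu3 -> D <= uncovered mu1 mu2 mu3) ->
  (exists mu1 mu2 mu3, [/\ matching_bits mu1, matching_bits mu2,
     matching_bits mu3 & uncovered mu1 mu2 mu3 = D]) ->
  m3 e = ((#|I| - D)%:R / #|I|%:R)%R.
Proof.
move=> lb [mu1 [mu2 [mu3 [m1 m2 m3 unc]]]]; rewrite /Defs.m3 card_edges.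
congr (_%:R / _)%R; apply/eqP; rewrite eqn_leq; apply/andP; split.
  apply/bigmax_leqP => M1 P1; apply/bigmax_leqP => M2 P2; apply/bigmax_leqP => M3 P3.
  have /andP [S1 _] := P1; have /andP [S2 _] := P2; have /andP [S3 _] := P3.
  have := card_covered S1 S2 S3.
  have := lb _ _ _ (perfect_matching_bits P1) (perfect_matching_bits P2)
            (perfect_matching_bits P3).
  lia.
pose N mu := [set ends i | i in [pred i : I | mu i]].
apply: leq_trans (leq_bigmax_cond _ (matching_bitsP m1)).
apply: leq_trans (leq_bigmax_cond _ (matching_bitsP m2)).
apply: leq_trans (leq_bigmax_cond _ (matching_bitsP m3)).
rewrite -/(N mu1) -/(N mu2) -/(N mu3).
have /andP [S1 _] := matching_bitsP m1; have /andP [S2 _] := matching_bitsP m2.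
have /andP [S3 _] := matching_bitsP m3.
rewrite -(card_covered S1 S2 S3) -unc.
suff -> : uncovered mu1 mu2 mu3 = uncovered (fun i => ends i \in N mu1)
   (fun i => ends i \in N mu2) (fun i => ends i \in N mu3) by rewrite addnK.
by apply: eq_bigr => i _; rewrite !mem_imset.
Qed.

Lemma inc_graph_girth5 :
  (forall x y z, e x y -> e y z -> e z x -> False) ->
  (forall x y z w, e x y -> e y z -> e z w -> e w x -> x != z -> y != w -> False) ->
  (exists c, is_cycle e c /\ size c = 5) -> girth_eq e 5.
Proof.
move=> no3 no4 ex5; split=> // -[|x [|y [|z [|w [|u c]]]]] /and3P [] //=.
  by move=> _ _ /and4P [xy yz zx _]; case: (no3 _ _ _ xy yz zx).
rewrite !inE !negb_or => /and4P [/and3P [_ xz _] /andP [_ yw] _ _] _.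
by case/and5P => xy yz zw wx _; case: (no4 _ _ _ _ xy yz zw wx).
Qed.

End IncidenceGraph.

(** * The blocks: edge cuts *)

(* The Petersen graph minus two adjacent vertices is the cycle 0..7 with chords 1-5
   and 3-7; the neighbours of one deleted vertex are 0 and 4, those of the other are
   2 and 6. A block always has its left ends at 0 and 4: the type [false] is the same
   graph with the labels 2 and 4 exchanged. *)
Definition p8_edges (t : bool) : seq (nat * nat) :=
  if t then
    [:: (0, 1); (0, 7); (1, 2); (1, 5); (2, 3); (3, 4); (3, 7); (4, 5); (5, 6); (6, 7)]
  else
    [:: (0, 1); (0, 7); (1, 4); (1, 5); (2, 3); (2, 5); (3, 4); (3, 7); (5, 6); (6, 7)].

(* The Petersen graph (outer cycle 0..4, spokes i - i+5) minus 0-1 and 2-3. *)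
Definition p10_edges : seq (nat * nat) :=
  [:: (1, 2); (3, 4); (0, 4); (0, 5); (1, 6); (2, 7); (3, 8); (4, 9);
      (5, 7); (6, 8); (7, 9); (5, 8); (6, 9)].

Definition junction : seq (nat * nat) := [:: (2, 8); (6, 9)].

Definition block_edges (t : bool) : seq (nat * nat) :=
  p8_edges t ++ junction ++ [seq (8 + e.1, 8 + e.2) | e <- p10_edges].

Definition cross_edges : seq (nat * nat) := [:: (10, 0); (11, 4)].

(* The ends of a cross edge lie in consecutive blocks; the edges of index 25 and 26
   of [own_edges] are the cross edges. *)
Definition own_edges (t : bool) : seq (nat * nat) := block_edges t ++ cross_edges.

Definition cutn (es : seq (nat * nat)) (b : bitseq) : nat :=
  count (fun e => nth false b e.1 != nth false b e.2) es.

Arguments cutn : simpl never.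

Fixpoint bitseqs (n : nat) : seq bitseq :=
  if n is n'.+1 then [seq c :: b | c <- [:: true; false], b <- bitseqs n'] else [:: [::]].

Lemma mem_bitseqs b : b \in bitseqs (size b).
Proof. by elim: b => //= c b IH; case: c; rewrite !mem_cat map_f ?orbT. Qed.

(** The outer end of a dangling edge counts as outside the set, so each port in the set adds one to
    the boundary. *)
Definition cut_check n es (ports : seq nat) : bool :=
  all (fun b => (constant b || (1 < cutn es b)) &&
         ((count id b <= 1) || (3 < cutn es b + count (nth false b) ports)))
      (bitseqs n).

Lemma cut_check_p8 t : cut_check 8 (p8_edges t) [:: 0; 4; 2; 6].
Proof. by case: t; vm_compute. Qed.

Lemma cut_check_p10 : cut_check 10 p10_edges [:: 0; 1; 2; 3].
Proof. by vm_compute. Qed.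

Lemma cutn_block t b : cutn (block_edges t) b =
  cutn (p8_edges t) (take 8 b) +
  ((nth false b 2 != nth false b 8) + (nth false b 6 != nth false b 9)) +
  cutn p10_edges (drop 8 b).
Proof.
rewrite /cutn !count_cat count_map /= addn0 -!addnA; congr (_ + _).
  apply: eq_in_count => e ein; have : (e.1 < 8) && (e.2 < 8).
    by move: e ein; apply/allP; case: t.
  by case/andP => e1 e2; rewrite !nth_take.
by rewrite !nth_drop.
Qed.

Lemma constant_bits b : constant b -> b = nseq (size b) (head false b).
Proof. by case: b => //= x b /all_pred1P ->; rewrite size_nseq. Qed.

Lemma half_cuts t b : size b = 18 ->
  let b8 := take 8 b in let b10 := drop 8 b in
  [/\ [\/ b8 = nseq 8 true, b8 = nseq 8 false | 1 < cutn (p8_edges t) b8],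
      [\/ b10 = nseq 10 true, b10 = nseq 10 false | 1 < cutn p10_edges b10],
      1 < count id b8 ->
        3 < cutn (p8_edges t) b8 + count (nth false b8) [:: 0; 4; 2; 6] &
      1 < count id b10 ->
        3 < cutn p10_edges b10 + count (nth false b10) [:: 0; 1; 2; 3]].
Proof.
move=> sb b8 b10.
have s8 : size b8 = 8 by rewrite size_takel ?sb.
have s10 : size b10 = 10 by rewrite size_drop sb.
have := allP (cut_check_p8 t) b8; rewrite -[in bitseqs _]s8 => /(_ (mem_bitseqs _)).
case/andP => c8 d8.
have := allP cut_check_p10 b10; rewrite -[in bitseqs _]s10 => /(_ (mem_bitseqs _)).
case/andP => c10 d10; split.
- case/orP: c8 => [/constant_bits|]; last by constructor 3.
  by rewrite s8; case: (head _ _); [constructor 1 | constructor 2].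
- case/orP: c10 => [/constant_bits|]; last by constructor 3.
  by rewrite s10; case: (head _ _); [constructor 1 | constructor 2].
- by rewrite ltnNge => c; rewrite (negbTE c) in d8.
by rewrite ltnNge => c; rewrite (negbTE c) in d10.
Qed.

Lemma nth_take8 b k : k < 8 -> nth false b k = nth false (take 8 b) k.
Proof. by move=> k8; rewrite nth_take. Qed.

Lemma nth_drop8 b k : nth false b (8 + k) = nth false (drop 8 b) k.
Proof. by rewrite nth_drop. Qed.

(** A nonconstant half costs at least two edges, and constant halves of different values cut both
    junction edges. *)
Lemma block_cut_le1 t b : size b = 18 -> cutn (block_edges t) b <= 1 ->
  b = nseq 18 true \/ b = nseq 18 false.
Proof.
move=> sb; rewrite cutn_block; have [h8 h10 _ _] := half_cuts t sb.
rewrite (@nth_take8 b 2) // (@nth_take8 b 6) // (nth_drop8 b 0) (nth_drop8 b 1).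
move: (cat_take_drop 8 b) h8 h10; move: (take 8 b) (drop 8 b) => b8 b10 <-.
by case=> [->|->|c8]; case=> [->|->|c10] /=; (try by [left|right]); lia.
Qed.

(** Two split halves cut two edges each, and a full block has four ports. A full half beside a split
    or empty one gives two outer ports and two cut edges. Beside an empty half, the junction edges
    act as dangling edges and the check of the other half applies. *)
Lemma block_boundary_ge4 t b : size b = 18 -> 1 < count id b ->
  3 < cutn (block_edges t) b + count (nth false b) [:: 0; 4; 10; 11].
Proof.
move=> sb; rewrite cutn_block; have [h8 h10] := half_cuts t sb.
rewrite -[in count id b](cat_take_drop 8 b) count_cat /=.
rewrite (@nth_take8 b 2) // (@nth_take8 b 6) // (@nth_take8 b 0) // (@nth_take8 b 4) //.
rewrite (nth_drop8 b 0) (nth_drop8 b 1) (nth_drop8 b 2) (nth_drop8 b 3).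
move: h8 h10; move: (take 8 b) (drop 8 b) => b8 b10.
by case=> [->|->|c8]; case=> [->|->|c10] /=; lia.
Qed.

(** * The blocks: perfect matchings *)

Fixpoint load (p : nat) (es : seq (nat * nat)) (x : bitseq) : nat :=
  match es, x with
  | e :: es', c :: x' => ((p == e.1) + (p == e.2)) * c + load p es' x'
  | _, _ => 0
  end.

Definition exact_cover n es x : bool := all (fun p => load p es x == 1) (iota 0 n).

(* The decided edges cover no vertex twice, and cover every vertex that no undecided
   edge can still reach. *)
Definition prefix_ok n (es : seq (nat * nat)) (x : bitseq) : bool :=
  all (fun p => (load p es x <= 1) &&
         (has (fun e => (p == e.1) || (p == e.2)) (drop (size x) es) || (load p es x == 1)))
      (iota 0 n).

Fixpoint prefixes n es k : seq bitseq :=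
  if k is k'.+1 then
    [seq x <- flatten [seq [:: rcons x true; rcons x false] | x <- prefixes n es k'] | prefix_ok n es x]
  else [:: [::]].

Definition exact_covers n es : seq bitseq := prefixes n es (size es).

Lemma load_cat p es x y :
  load p es (x ++ y) = load p es x + load p (drop (size x) es) y.
Proof.
elim: x es => [|c x IH] [|e es] //=.
by rewrite IH addnA.
Qed.

Lemma load_eq0 p es x :
  ~~ has (fun e => (p == e.1) || (p == e.2)) es -> load p es x = 0.
Proof.
elim: es x => [|e es IH] [|c x] //=; rewrite !negb_or => /andP [/andP [/negbTE -> /negbTE ->]].
exact: IH.
Qed.

Lemma prefix_okP n es x y : exact_cover n es (x ++ y) -> prefix_ok n es x.
Proof.
move=> /allP xP; apply/allP => p /xP /eqP; rewrite load_cat => l1.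
case: (boolP (has _ _)) => [_|/load_eq0 l0].
  by rewrite orTb andbT -l1 leq_addr.
by rewrite -l1 l0 addn0 leqnn eqxx.
Qed.

(** Completeness of the pruned search: every prefix of an exact cover passes [prefix_ok], by
    induction on the prefix. *)
Lemma mem_exact_covers n es x : size x = size es -> exact_cover n es x ->
  x \in exact_covers n es.
Proof.
rewrite /exact_covers => <- xP.
suff H y z : x = y ++ z -> y \in prefixes n es (size y) by apply: (H x [::]); rewrite cats0.
elim/last_ind: y z => //= y c IH z xE; rewrite size_rcons /= mem_filter.
rewrite (@prefix_okP n es _ z) -?xE //=.
apply/flatten_mapP; exists y; first by apply: (IH (c :: z)); rewrite xE cat_rcons.
by case: c {xE IH}; rewrite !inE eqxx ?orbT.
Qed.

Fixpoint unc3 (x y z : bitseq) : nat :=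
  match x, y, z with
  | a :: x', b :: y', c :: z' => ~~ [|| a, b | c] + unc3 x' y' z'
  | _, _, _ => 0
  end.

(** Each argument is the trace of one matching on the two edges. Three different traces, none using
    both edges, must be 10, 01 and 00. *)
Definition distinct_colors (x y z : bitseq) : bool :=
  uniq [:: x; y; z] && ([:: true; true] \notin [:: x; y; z]).

(* A lower bound, found by exhaustive search, for the cost of [P10] as a
   function of its left state; it splits the bound for a block into one check for each of
   [P8] and [P10]. *)
Definition junction_potential (x y z : bitseq) : nat :=
  let l := [:: x; y; z] in let both := [:: true; true] \in l in
  1 + both + (both && (count_mem [:: false; false] l == 2)).

(* The vertex 8 (resp. 10, 18) is out of range: it stands for the outer end of a
   dangling edge. The order is left edges, inner edges, right edges. *)
Definition p8_semi (t : bool) : seq (nat * nat) :=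
  [:: (8, 0); (8, 4)] ++ p8_edges t ++ [:: (2, 8); (6, 8)].

Definition p10_semi : seq (nat * nat) :=
  [:: (10, 0); (10, 1)] ++ p10_edges ++ [:: (2, 10); (3, 10)].

Definition all3 (P : bitseq -> bitseq -> bitseq -> bool) (l : seq bitseq) : bool :=
  all (fun x => all (fun y => all (P x y) l) l) l.

(** Positions 0 and 1 hold the left edges, 12 and 13 the junction. Missed junction edges are charged
    to P8, missed right edges to P10, and missed left edges to the preceding block. *)
Definition p8_ok (t : bool) (x y z : bitseq) : bool :=
  3 * t + distinct_colors (take 2 x) (take 2 y) (take 2 z) <=
  unc3 (drop 2 x) (drop 2 y) (drop 2 z) +
  junction_potential (drop 12 x) (drop 12 y) (drop 12 z).

Definition p10_ok (x y z : bitseq) : bool :=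
  junction_potential (take 2 x) (take 2 y) (take 2 z) <=
  unc3 (drop 2 x) (drop 2 y) (drop 2 z) +
  distinct_colors (drop 15 x) (drop 15 y) (drop 15 z).

Lemma p8_okP t : all3 (p8_ok t) (exact_covers 8 (p8_semi t)).
Proof. by case: t; vm_compute. Qed.

Lemma p10_okP : all3 p10_ok (exact_covers 10 p10_semi).
Proof. by vm_compute. Qed.

Definition block_semi (t : bool) : seq (nat * nat) :=
  [:: (18, 0); (18, 4)] ++ block_edges t ++ [:: (10, 18); (11, 18)].

(** The first 14 edges of [block_semi] are those meeting P8, the last 17 those meeting P10; the two
    windows share the junction edges. *)
Lemma load_p8 t x p : size x = 29 -> p < 8 ->
  load p (block_semi t) x = load p (p8_semi t) (take 14 x).
Proof.
move=> sx p8; rewrite -{1}(cat_take_drop 14 x) load_cat size_takel ?sx //.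
rewrite (@load_eq0 _ (drop _ _)) ?addn0; last first.
  by case: t; move: p p8; do 8 case=> //.
have : size (take 14 x) = 14 by rewrite size_takel ?sx.
move: (take 14 x) => y; do 14 case: y => [|? y] //; case: y => // _.
by case: t; move: p p8; do 8 case=> //.
Qed.

Lemma load_p10 t x p : size x = 29 -> p < 10 ->
  load (8 + p) (block_semi t) x = load p p10_semi (drop 12 x).
Proof.
move=> sx p10; rewrite -{1}(cat_take_drop 12 x) load_cat size_takel ?sx //.
rewrite (_ : load _ _ (take 12 x) = 0) ?add0n; last first.
  have : size (take 12 x) = 12 by rewrite size_takel ?sx.
  move: (take 12 x) => y; do 12 case: y => [|? y] //; case: y => // _.
  by case: t; move: p p10; do 10 case=> //.
have : size (drop 12 x) = 17 by rewrite size_drop sx.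
move: (drop 12 x) => y; do 17 case: y => [|? y] //; case: y => // _.
by case: t; move: p p10; do 10 case=> //.
Qed.

Lemma unc3_cat x y z x' y' z' : size x = size y -> size x = size z ->
  unc3 (x ++ x') (y ++ y') (z ++ z') = unc3 x y z + unc3 x' y' z'.
Proof.
elim: x y z => [|a x IH] [|b y] [|c z] //= [sy] [sz].
by rewrite IH // addnA.
Qed.

(** The inequalities for the two halves are added, and the junction potential cancels. *)
Lemma block_uncovered t x y z :
  size x = 29 -> size y = 29 -> size z = 29 ->
  exact_cover 18 (block_semi t) x -> exact_cover 18 (block_semi t) y ->
  exact_cover 18 (block_semi t) z ->
  3 * t + distinct_colors (take 2 x) (take 2 y) (take 2 z) <=
  unc3 (drop 2 x) (drop 2 y) (drop 2 z) +
  distinct_colors (drop 27 x) (drop 27 y) (drop 27 z).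
Proof.
have H8 w : size w = 29 -> exact_cover 18 (block_semi t) w ->
    take 14 w \in exact_covers 8 (p8_semi t).
  move=> sw /allP wP; apply: mem_exact_covers.
    by rewrite size_takel ?sw //; case: t {wP}.
  apply/allP => p; rewrite mem_iota => p8.
  by rewrite -load_p8 //; apply: wP; rewrite mem_iota; lia.
have H10 w : size w = 29 -> exact_cover 18 (block_semi t) w ->
    drop 12 w \in exact_covers 10 p10_semi.
  move=> sw /allP wP; apply: mem_exact_covers.
    by rewrite size_drop sw.
  apply/allP => p; rewrite mem_iota => p10.
  by rewrite -(load_p10 t) //; apply: wP; rewrite mem_iota; lia.
move=> sx sy sz cx cy cz.
have := allP (allP (allP (p8_okP t) _ (H8 _ sx cx)) _ (H8 _ sy cy)) _ (H8 _ sz cz).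
have := allP (allP (allP p10_okP _ (H10 _ sx cx)) _ (H10 _ sy cy)) _ (H10 _ sz cz).
rewrite /p8_ok /p10_ok.
have E (w : bitseq) : size w = 29 -> [/\ take 2 (take 14 w) = take 2 w,
    drop 12 (take 14 w) = take 2 (drop 12 w),
    drop 15 (drop 12 w) = drop 27 w &
    drop 2 w = drop 2 (take 14 w) ++ drop 2 (drop 12 w)].
  move=> sw; rewrite take_takel // !drop_drop; split=> //.
    by do 29 case: w sw => // ? w sw; case: w sw.
  by do 29 case: w sw => // ? w sw; case: w sw.
have [-> -> -> ->] := E x sx; have [-> -> -> ->] := E y sy; have [-> -> -> ->] := E z sz.
rewrite unc3_cat; last 2 first.
  by rewrite !size_drop !size_takel ?sx ?sy.
  by rewrite !size_drop !size_takel ?sx ?sz.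
lia.
Qed.

(** * The ring of blocks *)

Definition own_edge (t : bool) (k : nat) : nat * nat := nth (0, 0) (own_edges t) k.

Lemma own_edge_bounds t k : k < 27 ->
  [/\ (own_edge t k).1 < 18, (own_edge t k).2 < 18 & (own_edge t k).1 != (own_edge t k).2].
Proof.
move=> k27; apply/and3P.
have : all (fun e : nat * nat => [&& e.1 < 18, e.2 < 18 & e.1 != e.2]) (own_edges t).
  by case: t.
by move/allP; apply; rewrite mem_nth //; case: t.
Qed.

Lemma own_edge_inj t k l : k < 27 -> l < 27 -> own_edge t k = own_edge t l -> k = l.
Proof.
move=> k27 l27 /eqP; rewrite nth_uniq; [by move/eqP|by case: t..].
Qed.

(** Labels alone exclude a reversed copy of an edge, whichever blocks own the two edges. *)
Lemma own_edge_swap t t' k l : k < 27 -> l < 27 ->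
  (own_edge t k).1 = (own_edge t' l).2 -> (own_edge t k).2 = (own_edge t' l).1 -> False.
Proof.
move=> k27 l27 e12 e21.
have : all (fun e : nat * nat => (e.2, e.1) \notin own_edges t') (own_edges t).
  by case: t {e12 e21}; case: t'.
move/allP => /(_ (own_edge t k)); rewrite mem_nth; last by case: t {e12 e21}.
move=> /(_ isT); rewrite e12 e21 -surjective_pairing mem_nth //.
by case: t' {e12 e21}.
Qed.

Section RingEdges.
Variables (m : nat) (tau : 'I_m -> bool).

Definition ring_src (x : 'I_m * 'I_27) : 'I_m * 'I_18 :=
  (x.1, inord (own_edge (tau x.1) x.2).1).

Definition ring_dst (x : 'I_m * 'I_27) : 'I_m * 'I_18 :=
  (if x.2 < 25 then x.1 else ordS x.1, inord (own_edge (tau x.1) x.2).2).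

Lemma inord_eq (k l : nat) : k < 18 -> l < 18 -> (inord k == inord l :> 'I_18) = (k == l).
Proof. by move=> k18 l18; rewrite -val_eqE /= !inordK. Qed.

Lemma ring_loopless x : ring_src x != ring_dst x.
Proof.
have [b1 b2 b12] := own_edge_bounds (tau x.1) (ltn_ord x.2).
by rewrite xpair_eqE inord_eq // negb_and b12 orbT.
Qed.

Lemma ring_ends_inj : injective (ends ring_src ring_dst).
Proof.
move=> x y exy.
have := ring_loopless x; have : ring_src x \in ends ring_src ring_dst y.
  by rewrite -exy !inE eqxx.
have : ring_dst x \in ends ring_src ring_dst y by rewrite -exy !inE eqxx orbT.
have [bx1 bx2 _] := own_edge_bounds (tau x.1) (ltn_ord x.2).
have [by1 by2 _] := own_edge_bounds (tau y.1) (ltn_ord y.2).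
rewrite !inE => /orP [] /eqP ed /orP [] /eqP es; rewrite es ed ?eqxx // => _.
  case/eqP: es; rewrite xpair_eqE inord_eq // => /andP [_ /eqP e1].
  case/eqP: ed; rewrite xpair_eqE inord_eq // => /andP [_ /eqP e2].
  by case: (own_edge_swap _ _ e1 e2).
case/eqP: es; rewrite xpair_eqE inord_eq // => /andP [/eqP e0 /eqP e1].
case/eqP: ed; rewrite xpair_eqE inord_eq // => /andP [_ /eqP e2].
case: x y e0 e1 e2 {exy bx1 bx2 by1 by2} => i k [j l] /= <- e1 e2.
congr (_, _); apply: val_inj; apply: (@own_edge_inj (tau i) _ _ (ltn_ord k) (ltn_ord l)).
by rewrite (surjective_pairing (own_edge _ k)) e1 e2 -surjective_pairing.
Qed.

(** The order is that of [block_semi]: the left edges are the cross edges owned by the preceding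
    block. *)
Definition ring_bits (mu : 'I_m * 'I_27 -> bool) (i : 'I_m) : bitseq :=
  [:: mu (ord_pred i, inord 25); mu (ord_pred i, inord 26)] ++
  mkseq (fun k => mu (i, inord k)) 27.

(** Only block [i] and its predecessor own edges that meet block [i]. *)
Lemma sum_ring_vertex (mu : 'I_m * 'I_27 -> bool) i (p : 'I_18) :
  \sum_x mu x * incident ring_src ring_dst (i, p) x =
  load p (block_semi (tau i)) (ring_bits mu i).
Proof.
pose nu j k := mu (j, inord k).
(* [B j] counts the edges owned by block [j] at their ends inside it, [C j] its two cross edges at
   their ends in the next block. *)
pose B j := \sum_(0 <= k < 25) nu j k *
    ((p == (own_edge (tau j) k).1 :> nat) + (p == (own_edge (tau j) k).2 :> nat)) +
    (nu j 25 * (p == 10 :> nat) + nu j 26 * (p == 11 :> nat)).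
pose C j := nu j 25 * (p == 0 :> nat) + nu j 26 * (p == 4 :> nat).
have row j : \sum_k mu (j, k) * incident ring_src ring_dst (i, p) (j, k) =
    (i == j) * B j + (i == ordS j) * C j.
  have ->: \sum_k mu (j, k) * incident ring_src ring_dst (i, p) (j, k) =
    \sum_(k < 27) nu j k * (((i == j) && (p == (own_edge (tau j) k).1 :> nat)) +
      ((i == if k < 25 then j else ordS j) && (p == (own_edge (tau j) k).2 :> nat))).
    apply: eq_bigr => k _; rewrite /nu inord_val /incident !xpair_eqE /=.
    have [b1 b2 _] := own_edge_bounds (tau j) (ltn_ord k).
    by rewrite -[p in X in X + _](inord_val p) -[p in X in _ + X](inord_val p) !inord_eq.
  rewrite -(big_mkord xpredT (fun k => nu j k * (((i == j) && (p == (own_edge (tau j) k).1 :> nat)) +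
      ((i == if k < 25 then j else ordS j) && (p == (own_edge (tau j) k).2 :> nat))))).
  rewrite big_nat_recr // big_nat_recr // /B [(i == j) * (_ + _)]mulnDr big_distrr /=.
  have -> : own_edge (tau j) 25 = (10, 0) by case: (tau j).
  have -> : own_edge (tau j) 26 = (11, 4) by case: (tau j).
  rewrite /= /C; set S1 := \sum_(0 <= k < 25) _; set S2 := \sum_(0 <= k < 25) _.
  have -> : S1 = S2.
    by apply: eq_big_nat => k /andP [_ k25]; rewrite k25; case: (i == j); lia.
  by case: (i == j); case: (i == ordS j); rewrite /=; ring.
transitivity (B i + C (ord_pred i)).
  have -> : \sum_x mu x * incident ring_src ring_dst (i, p) x =
      \sum_j \sum_k mu (j, k) * incident ring_src ring_dst (i, p) (j, k).
    by rewrite pair_bigA; apply: eq_bigr => -[].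
  under eq_bigr => j _ do rewrite row.
  rewrite big_split /=; congr (_ + _).
    rewrite (bigD1 i) //= eqxx mul1n big1 ?addn0 // => j /negbTE.
    by rewrite eq_sym => ->.
  rewrite (bigD1 (ord_pred i)) //= ord_predK eqxx mul1n big1 ?addn0 // => j jp.
  by rewrite -(inj_eq (@ord_pred_inj m)) ordSK eq_sym (negbTE jp).
have p18 : (p == 18 :> nat) = false by apply/eqP => pE; have := ltn_ord p; rewrite pE.
rewrite /B /C /ring_bits -/(nu _ 25) -/(nu _ 26) unlock /= /nu.
by case: (tau i); rewrite /= p18 (_ : nat_of_bool false = 0) //; ring.
Qed.
End RingEdges.

(** * Perfect matchings of the ring *)

Section RingMatchings.
Variables (m : nat) (tau : 'I_m -> bool).
Notation src := (ring_src tau).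
Notation dst := (ring_dst tau).

(** The degree is the load with all 29 bits set, a finite check for each type. *)
Lemma ring_degree v : \sum_x incident src dst v x = 3.
Proof.
case: v => i p; have := sum_ring_vertex tau xpredT i p.
under eq_bigr => x _ do rewrite mul1n.
move=> ->; have : all (fun q => load q (block_semi (tau i)) (nseq 29 true) == 3) (iota 0 18).
  by case: (tau i).
by move/allP => /(_ p); rewrite mem_iota ltn_ord => /(_ isT) /eqP.
Qed.

Lemma matching_bits_ring mu :
  matching_bits src dst mu <->
  forall i, exact_cover 18 (block_semi (tau i)) (ring_bits mu i).
Proof.
split=> [muP i|muP [i p]].
  apply/allP => p; rewrite mem_iota /= add0n => p18.
  by have := sum_ring_vertex tau mu i (Ordinal p18); rewrite muP => /esym/eqP.
by rewrite sum_ring_vertex; apply/eqP/(allP (muP i)); rewrite mem_iota /= ltn_ord.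
Qed.

Lemma unc3_map (T : Type) (f g h : T -> bool) (l : seq T) :
  unc3 (map f l) (map g l) (map h l) = \sum_(k <- l) ~~ [|| f k, g k | h k].
Proof. by elim: l => [|k l IH] /=; rewrite ?big_nil ?big_cons ?IH. Qed.

(** Dropping the two left bits counts each edge once, at its owner. *)
Lemma uncovered_ring (mu1 mu2 mu3 : 'I_m * 'I_27 -> bool) : uncovered mu1 mu2 mu3 =
  \sum_i unc3 (drop 2 (ring_bits mu1 i)) (drop 2 (ring_bits mu2 i))
              (drop 2 (ring_bits mu3 i)).
Proof.
rewrite /uncovered; transitivity (\sum_(i : 'I_m) \sum_(k : 'I_27)
    ~~ [|| mu1 (i, k), mu2 (i, k) | mu3 (i, k)] : nat).
  by rewrite pair_bigA; apply: eq_bigr => -[].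
apply: eq_bigr => i _.
have E (mu : 'I_m * 'I_27 -> bool) :
  drop 2 (ring_bits mu i) = [seq mu (i, inord k) | k <- iota 0 27] by [].
rewrite !E unc3_map -[iota 0 27]/(index_iota 0 27) big_mkord.
by apply: eq_bigr => k _; rewrite inord_val.
Qed.

(* Telescoping: the right end of block [i] is the left end of block [ordS i]. *)
Lemma ring_uncovered_ge mu1 mu2 mu3 :
  matching_bits src dst mu1 -> matching_bits src dst mu2 -> matching_bits src dst mu3 ->
  3 * \sum_i tau i <= uncovered mu1 mu2 mu3.
Proof.
move=> /matching_bits_ring c1 /matching_bits_ring c2 /matching_bits_ring c3.
pose st (mu : 'I_m * 'I_27 -> bool) (i : 'I_m) := [:: mu (i, inord 25); mu (i, inord 26)].
pose D i := nat_of_bool (distinct_colors (st mu1 i) (st mu2 i) (st mu3 i)).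
pose U i := unc3 (drop 2 (ring_bits mu1 i)) (drop 2 (ring_bits mu2 i))
                 (drop 2 (ring_bits mu3 i)).
have key i : 3 * tau i + D (ord_pred i) <= U i + D i.
  exact: (@block_uncovered (tau i) (ring_bits mu1 i) (ring_bits mu2 i) (ring_bits mu3 i)).
have : \sum_i (3 * tau i + D (ord_pred i)) <= \sum_i (U i + D i).
  by apply: leq_sum => i _; apply: key.
rewrite big_split [leqRHS]big_split /= [\sum_i D i](reindex_inj (@ord_pred_inj m)) leq_add2r.
by move=> H; rewrite uncovered_ring big_distrr.
Qed.

(* Found by computer search: indices into [own_edges] of three matchings of a block,
   the first avoiding both cross edges, the others using one each. *)
Definition matching_table (c : nat) (t : bool) : seq nat :=
  if t then
    nth [::] [:: [:: 0; 4; 7; 9; 12; 14; 18; 20; 24];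
                 [:: 2; 6; 7; 11; 13; 15; 21; 22; 25];
                 [:: 0; 6; 8; 10; 16; 17; 19; 23; 26]] c
  else
    nth [::] [:: [:: 0; 5; 6; 9; 12; 14; 18; 20; 24];
                 [:: 2; 7; 8; 10; 13; 16; 22; 23; 25];
                 [:: 1; 3; 4; 11; 15; 17; 19; 21; 26]] c.

Definition ring_matching (c : nat) (x : 'I_m * 'I_27) : bool :=
  val x.2 \in matching_table c (tau x.1).

(** Both types use the cross edges alike, so the left bits do not depend on the type of the
    preceding block and the types can be mixed freely. *)
Lemma ring_bits_matching c i : c < 3 -> ring_bits (ring_matching c) i =
  [:: c == 1; c == 2] ++ [seq k \in matching_table c (tau i) | k <- iota 0 27].
Proof.
move=> c3; rewrite /ring_bits /ring_matching /mkseq /= !inordK //.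
by case: (tau (ord_pred i)); case: (tau i); move: c c3; do 3 case=> //.
Qed.

Lemma ring_matchingP c : c < 3 -> matching_bits src dst (ring_matching c).
Proof.
move=> c3; apply/matching_bits_ring => i; rewrite ring_bits_matching //.
by case: (tau i); move: c c3; do 3 case=> //.
Qed.

Lemma uncovered_ring_matching :
  uncovered (ring_matching 0) (ring_matching 1) (ring_matching 2) = 3 * \sum_i tau i.
Proof.
rewrite uncovered_ring big_distrr; apply: eq_bigr => i _.
by rewrite !ring_bits_matching //; case: (tau i).
Qed.

End RingMatchings.

(** * Edge cuts of the ring *)

Lemma val_iter_ordS m (j : 'I_m) k : val (iter k (@ordS m) j) = (j + k) %% m.
Proof.
elim: k => [|k IH] /=; first by rewrite addn0 modn_small.
by rewrite IH -addn1 modnDml addn1 addnS.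
Qed.

Lemma iter_ordSP m (i j : 'I_m) : exists2 k, k < m & i = iter k (@ordS m) j.
Proof.
have m0 : 0 < m by apply: leq_ltn_trans (ltn_ord i).
exists ((i + (m - j)) %% m); first by rewrite ltn_pmod.
apply: val_inj; rewrite val_iter_ordS modnDmr addnC -addnA subnK; last exact: ltnW.
by rewrite modnDr modn_small.
Qed.

Lemma ordS_neq m (i : 'I_m) : 1 < m -> ordS i != i.
Proof.
move=> m1; rewrite -val_eqE /=; have := ltn_ord i.
rewrite leq_eqVlt => /orP [/eqP im|im]; last by rewrite modn_small //; lia.
by rewrite im modnn; lia.
Qed.

Lemma leq_sum_two (I : finType) (F : I -> nat) i j : i != j -> F i + F j <= \sum_k F k.
Proof.
move=> ij; rewrite (bigD1 i) //= (bigD1 j) /=; last by rewrite eq_sym.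
by rewrite addnA leq_addr.
Qed.

Section RingCuts.
Variables (m : nat) (tau : 'I_m -> bool).
Hypothesis m_gt1 : 1 < m.
Notation src := (ring_src tau).
Notation dst := (ring_dst tau).

Definition block_bits (X : pred ('I_m * 'I_18)) (i : 'I_m) : bitseq :=
  mkseq (fun p => X (i, inord p)) 18.

Definition cross_cut (b b' : bitseq) : nat :=
  (nth false b 10 != nth false b' 0) + (nth false b 11 != nth false b' 4).

Lemma cut_size_ring X : cut_size src dst X =
  \sum_i (cutn (block_edges (tau i)) (block_bits X i) +
          cross_cut (block_bits X i) (block_bits X (ordS i))).
Proof.
rewrite /cut_size; transitivity (\sum_(i : 'I_m) \sum_(k : 'I_27)
    (X (src (i, k)) != X (dst (i, k))) : nat).
  by rewrite pair_bigA; apply: eq_bigr => -[].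
apply: eq_bigr => i _.
pose G k : nat := nth false (block_bits X i) (own_edge (tau i) k).1 !=
  nth false (block_bits X (if k < 25 then i else ordS i)) (own_edge (tau i) k).2.
have -> : \sum_(k : 'I_27) (X (src (i, k)) != X (dst (i, k))) = \sum_(k < 27) G k.
  apply: eq_bigr => k _; have [b1 b2 _] := own_edge_bounds (tau i) (ltn_ord k).
  by rewrite /G !nth_mkseq.
rewrite -(big_mkord xpredT G) big_nat_recr //= big_nat_recr //= -addnA.
congr (_ + _); last by rewrite /G; case: (tau i).
rewrite /cutn -sum1_count [RHS]big_mkcond [RHS](big_nth (0, 0)).
have -> : size (block_edges (tau i)) = 25 by case: (tau i).
apply: eq_big_nat => k /andP [_ k25]; rewrite /G k25 /own_edge nth_cat.
have -> : size (block_edges (tau i)) = 25 by case: (tau i).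
by rewrite k25; case: (_ != _).
Qed.

Lemma size_block_bits X i : size (block_bits X i) = 18.
Proof. by rewrite size_mkseq. Qed.

(** At most one block [j] can own two or more cut edges. Every other block is constant, and a change
    of value between two consecutive ones would cut both cross edges. *)
Lemma cut_one_block X : cut_size src dst X <= 3 ->
  exists j c, forall i, i != j -> block_bits X i = nseq 18 c.
Proof.
pose D i := cutn (block_edges (tau i)) (block_bits X i) +
            cross_cut (block_bits X i) (block_bits X (ordS i)).
rewrite cut_size_ring => sumD; rewrite -[\sum_i _]/(\sum_i D i) in sumD.
have [j Dj] : exists j, forall i, i != j -> D i <= 1.
  case: (pickP (fun j => 1 < D j)) => [j Dj|D0].
    exists j => i ij; have := leq_sum_two D ij; lia.
  have i0 : 'I_m by apply: Ordinal (ltnW m_gt1).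
  by exists i0 => i _; have := D0 i; lia.
have pure i : i != j -> exists c, block_bits X i = nseq 18 c.
  move=> /Dj Di; have : cutn (block_edges (tau i)) (block_bits X i) <= 1 by rewrite /D in Di; lia.
  by case/(block_cut_le1 (size_block_bits _ _)) => ->; [exists true|exists false].
have [c cP] := pure _ (ordS_neq j m_gt1).
(* The value [c] is carried forward around the ring from the successor of [j], never passing [j]
   again. *)
exists j, c => i ij; have [k km iE] := iter_ordSP i j.
have {ij} k0 : 0 < k by case: k {km} iE ij => // -> /=; rewrite eqxx.
rewrite iE {i iE}; elim: k k0 km => // -[_|k IH] _ km; first exact: cP.
have neq l : 0 < l < m -> iter l (@ordS m) j != j.
  move=> /andP [l0 lm]; rewrite -val_eqE val_iter_ordS; apply/eqP => E.
  have jm := ltn_ord j.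
  have : (j + l) %% m = j %% m by rewrite E modn_small.
  move/eqP; rewrite -{2}[val j]addn0 eqn_modDl mod0n modn_small //; lia.
have Dk : D (iter k.+1 (@ordS m) j) <= 1 by apply/Dj/neq; lia.
have [c' c'P] : exists c', block_bits X (iter k.+2 (@ordS m) j) = nseq 18 c'.
  by apply/pure/neq; lia.
move: Dk; rewrite /D -iterS c'P IH //; last exact: ltnW.
by case: (c) (c') => -[]; rewrite // /cross_cut /=; lia.
Qed.

(** The cross edge at each port in the set is cut, so [block_boundary_ge4] forbids a second
    vertex. *)
Lemma cut_single_vertex X j : cut_size src dst X <= 3 ->
  (forall i, i != j -> block_bits X i = nseq 18 false) ->
  exists a, forall v, X v -> v = a.
Proof.
move=> cutX out.
have Xout i p : i != j -> X (i, p) = false.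
  move=> /out /(congr1 (fun b => nth false b p)); rewrite nth_mkseq // inord_val => ->.
  by rewrite nth_nseq if_same.
have cnt : count id (block_bits X j) <= 1.
  rewrite leqNgt; apply/negP => c1.
  have := block_boundary_ge4 (tau j) (size_block_bits X j) c1.
  have pj : ord_pred j != j by rewrite -(inj_eq (@ordS_inj m)) ord_predK eq_sym ordS_neq.
  move: cutX; rewrite cut_size_ring.
  (* The boundary of block [j] is split between two terms: the right cross edges belong to [j], the
     left ones to its predecessor. *)
  have := leq_sum_two (fun i => cutn (block_edges (tau i)) (block_bits X i) +
          cross_cut (block_bits X i) (block_bits X (ordS i))) pj.
  rewrite ord_predK (out _ pj) (out _ (ordS_neq j m_gt1)).
  move: (block_bits X j) => b; rewrite /cross_cut /=.
  by case: (nth false b 0); case: (nth false b 4); case: (nth false b 10);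
    case: (nth false b 11) => /=; lia.
have one p q : X (j, p) -> X (j, q) -> p = q.
  move=> Xp Xq; apply/eqP; apply: contraTT cnt => pq; rewrite -ltnNge.
  have -> : count id (block_bits X j) = #|[set r | X (j, r)]|.
    rewrite count_map -sum1_count -sum1_card big_mkcond [RHS]big_mkcond.
    rewrite -[iota 0 18]/(index_iota 0 18) big_mkord; apply: eq_bigr => r _.
    by rewrite /= inord_val inE.
  apply/card_gt1P; exists p, q; by rewrite ?inE.
case: (pickP (fun p => X (j, p))) => [p Xp|X0].
  exists (j, p) => -[i q] Xv; have [ij|ij] := eqVneq i j; last by rewrite Xout in Xv.
  by rewrite ij in Xv *; rewrite (one q p).
exists (j, ord0) => -[i q] Xv; have [ij|ij] := eqVneq i j; last by rewrite Xout in Xv.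
by rewrite ij X0 in Xv.
Qed.

Lemma ring_cut X : cut_size src dst X <= 3 ->
  (exists a, forall v, X v -> v = a) \/ (exists a, forall v, ~~ X v -> v = a).
Proof.
move=> cutX; have [j [[] jP]] := cut_one_block cutX; [right|left].
  (* The complement has the same cut and is empty outside block [j]. *)
  apply: (@cut_single_vertex (fun v => ~~ X v) j).
    by apply: leq_trans cutX; apply: leq_sum => x _; case: (X _); case: (X _).
  move=> i /jP E; have -> : block_bits (fun v => ~~ X v) i = map negb (block_bits X i).
    by rewrite -map_comp.
  by rewrite E.
exact: cut_single_vertex cutX jP.
Qed.
End RingCuts.

(** * Girth of the ring *)

Definition block_nbs (t : bool) (p : nat) : seq nat :=
  [seq e.2 | e <- block_edges t & e.1 == p] ++ [seq e.1 | e <- block_edges t & e.2 == p].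

Definition block_ports : seq nat := [:: 0; 4; 10; 11].

Definition triangle_check t : bool :=
  all (fun p => all (fun q => all (fun r => p \notin block_nbs t r) (block_nbs t q))
                    (block_nbs t p)) (iota 0 18).

Definition square_check t : bool :=
  all (fun p => all (fun q => all (fun r =>
         (r == p) || all (fun s => (s == q) || (p \notin block_nbs t s)) (block_nbs t r))
       (block_nbs t q)) (block_nbs t p)) (iota 0 18).

Lemma triangle_checkP t : triangle_check t.
Proof. by case: t; vm_compute. Qed.

Lemma square_checkP t : square_check t.
Proof. by case: t; vm_compute. Qed.

Section RingGirth.
Variables (m : nat) (tau : 'I_m -> bool).
Hypothesis m_gt1 : 1 < m.
Notation src := (ring_src tau).
Notation dst := (ring_dst tau).
Notation e := (inc_graph src dst).
Implicit Types x y z w : 'I_m * 'I_18.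

Definition inner x y : Prop := x.1 = y.1 /\ val y.2 \in block_nbs (tau x.1) x.2.

Definition crosses x y : Prop :=
  y.1 = ordS x.1 /\ (val x.2, val y.2) \in cross_edges.

Definition linked x y : Prop := crosses x y \/ crosses y x.

Lemma ring_adj x y : e x y -> inner x y \/ linked x y.
Proof.
case/existsP => -[i k] /eqP E.
have [b1 b2 _] := own_edge_bounds (tau i) (ltn_ord k).
have sxy : src (i, k) \in [set x; y] by rewrite -E !inE eqxx.
have dxy : dst (i, k) \in [set x; y] by rewrite -E !inE eqxx orbT.
have sd := ring_loopless tau (i, k).
have H : (x = src (i, k) /\ y = dst (i, k)) \/ (x = dst (i, k) /\ y = src (i, k)).
  move: sxy dxy sd; rewrite !inE.
  by case/orP => /eqP -> /orP [] /eqP ->; rewrite ?eqxx //; [left | right].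
have size25 : size (block_edges (tau i)) = 25 by case: (tau i).
have kE : k < 25 -> own_edge (tau i) k \in block_edges (tau i).
  by move=> k25; rewrite /own_edge nth_cat size25 k25 mem_nth ?size25.
have kC : (k < 25) = false -> own_edge (tau i) k \in cross_edges.
  move=> k25; rewrite /own_edge nth_cat size25 k25 mem_nth //=.
  by have := ltn_ord k; lia.
case: H => -[-> ->]; case: (boolP (k < 25)) => [k25|/negbTE k25].
- left; split; rewrite /= ?k25 // !inordK // mem_cat; apply/orP; left.
  by apply/mapP; exists (own_edge (tau i) k); rewrite // mem_filter eqxx kE.
- right; left; split; rewrite /= ?k25 // !inordK //.
  by rewrite -surjective_pairing kC.
- left; split; rewrite /= ?k25 // !inordK // mem_cat; apply/orP; right.
  by apply/mapP; exists (own_edge (tau i) k); rewrite // mem_filter eqxx kE.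
- right; right; split; rewrite /= ?k25 // !inordK //.
  by rewrite -surjective_pairing kC.
Qed.

Lemma linked_sym x y : linked x y -> linked y x.
Proof. by case; [right | left]. Qed.

Lemma crossesP x y : crosses x y ->
  y.1 = ordS x.1 /\ ((val x.2, val y.2) = (10, 0) \/ (val x.2, val y.2) = (11, 4)).
Proof. by case=> ->; rewrite !inE => /orP [] /eqP ->; split; auto. Qed.

Lemma linked_neq x y : linked x y -> x.1 <> y.1.
Proof.
move=> [] /crossesP [-> _] /eqP; first by rewrite eq_sym (negbTE (ordS_neq _ m_gt1)).
by rewrite (negbTE (ordS_neq _ m_gt1)).
Qed.

Lemma linked_port x y : linked x y -> val x.2 \in block_ports.
Proof. by case=> /crossesP [_ [] [p1 p2]]; rewrite -[val x.2]/(nat_of_ord x.2) ?p1 ?p2. Qed.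

(** Each port carries a single cross edge: 10 and 11 only start one, 0 and 4 only end one. *)
Lemma linked_uniq x y z : linked x y -> linked x z -> y = z.
Proof.
case: x y z => [i p] [j q] [l r].
move=> [] /crossesP [/= j1 j2] [] /crossesP [/= l1 l2].
- congr (_, _); first by rewrite j1 l1.
  by apply: val_inj => /=; case: j2 l2 => -[p1 q1] [] [p2 r1]; congruence.
- by case: j2 l2 => -[p1 q1] [] [p2 r1]; congruence.
- by case: j2 l2 => -[p1 q1] [] [p2 r1]; congruence.
congr (_, _); first by apply: (@ordS_inj m); rewrite -j1 -l1.
by apply: val_inj => /=; case: j2 l2 => -[p1 q1] [] [p2 r1]; congruence.
Qed.

Lemma inner_port x y : inner x y -> val x.2 \in block_ports -> val y.2 \notin block_ports.
Proof.
case=> _ yx xp; move: (val y.2) yx; apply/allP.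
have : all (fun p => all (fun q => q \notin block_ports) (block_nbs (tau x.1) p)) block_ports.
  by case: (tau x.1).
by move/allP; apply.
Qed.

Lemma ring_adj_irr x : e x x = false.
Proof. by rewrite inc_graph_irr //; apply: ring_loopless. Qed.

(* Ports are pairwise nonadjacent inside a block, so in a short cycle the two edges
   around a cross edge lead to vertices all of whose edges are inner. *)
Lemma linked_triangle x y z : linked x y -> e y z -> e z x -> False.
Proof.
move=> xy /ring_adj [yz|/(linked_uniq (linked_sym xy)) <-]; last by rewrite ring_adj_irr.
have zp := inner_port yz (linked_port (linked_sym xy)).
move=> /ring_adj [[zx _]|/linked_port]; last by rewrite (negbTE zp).
by case: (linked_neq xy); rewrite -zx; case: yz.
Qed.

Lemma linked_square x y z w : linked x y -> e y z -> e z w -> e w x ->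
  x != z -> y != w -> False.
Proof.
move=> xy /ring_adj [yz|/(linked_uniq (linked_sym xy)) ->]; last by rewrite eqxx.
move=> zw /ring_adj [wx|/linked_sym /(linked_uniq xy) ->]; last by rewrite eqxx.
have zp := inner_port yz (linked_port (linked_sym xy)) => _ _.
case/ring_adj: zw => [[zw _]|/linked_port]; last by rewrite (negbTE zp).
by case: (linked_neq xy); rewrite -(proj1 wx) -zw; case: yz.
Qed.

Lemma ring_no_triangle x y z : e x y -> e y z -> e z x -> False.
Proof.
move=> xy yz zx.
(* A triangle with a cross edge is rotated to start there; otherwise it stays in one block and the
   finite check applies. *)
case: (ring_adj xy) => [[i1 n1]|l]; last exact: linked_triangle l yz zx.
case: (ring_adj yz) => [[i2 n2]|l]; last exact: linked_triangle l zx xy.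
case: (ring_adj zx) => [[i3 n3]|l]; last exact: linked_triangle l xy yz.
rewrite -i1 in n2; rewrite i3 in n3.
have /allP /(_ (val x.2)) := triangle_checkP (tau x.1).
rewrite mem_iota ltn_ord => /(_ isT) /allP /(_ _ n1) /allP /(_ _ n2).
by rewrite n3.
Qed.

Lemma ring_no_square x y z w : e x y -> e y z -> e z w -> e w x ->
  x != z -> y != w -> False.
Proof.
move=> xy yz zw wx xz yw.
case: (ring_adj xy) => [[i1 n1]|l]; last exact: linked_square l yz zw wx xz yw.
case: (ring_adj yz) => [[i2 n2]|l].
  2: by apply: linked_square l zw wx xy yw _; rewrite eq_sym.
case: (ring_adj zw) => [[i3 n3]|l].
  2: by apply: linked_square l wx xy yz _ _; rewrite eq_sym.
case: (ring_adj wx) => [[i4 n4]|l].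
  2: by apply: linked_square l xy yz zw _ xz; rewrite eq_sym.
rewrite -i1 in n2; rewrite -i2 -i1 in n3; rewrite i4 in n4.
have /allP /(_ (val x.2)) := square_checkP (tau x.1).
rewrite mem_iota ltn_ord => /(_ isT) /allP /(_ _ n1) /allP /(_ _ n2).
case/orP => [/eqP/val_inj zx2|/allP /(_ _ n3)].
  case/eqP: xz; case: (x) (z) i1 i2 zx2 => [a b] [c d] /= -> -> -> //.
rewrite n4 orbF => /eqP/val_inj wy2.
by case/eqP: yw; case: (y) (w) i2 i3 wy2 => [a b] [c d] /= -> -> ->.
Qed.

Lemma ring_pentagon : exists a b c d f : 'I_m * 'I_18,
  [/\ uniq [:: a; b; c; d; f], e a b, e b c, e c d & e d f && e f a].
Proof.
have i : 'I_m := Ordinal (ltnW m_gt1).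
have eE k : k < 25 ->
    e (i, inord (own_edge (tau i) k).1) (i, inord (own_edge (tau i) k).2).
  move=> k25; apply/existsP; exists (i, inord k).
  by rewrite /ends /ring_src /ring_dst /= inordK ?k25 //; lia.
pose v p : 'I_m * 'I_18 := (i, inord p).
(* The edges of this 5-cycle have indices 0, 3, 8, 9, 1 in both versions of P8. *)
exists (v 0), (v 1), (v 5), (v 6), (v 7).
have H k p q : k < 25 -> own_edge (tau i) k = (p, q) -> e (v p) (v q).
  by move=> /eE; rewrite /v => + E; rewrite E.
split.
- by rewrite /= !inE !xpair_eqE !eqxx !inord_eq.
- by apply: (H 0) => //; case: (tau i).
- by apply: (H 3) => //; case: (tau i).
- by apply: (H 8) => //; case: (tau i).
rewrite [e (v 7) _]inc_graph_sym; apply/andP; split.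
  by apply: (H 9) => //; case: (tau i).
by apply: (H 1) => //; case: (tau i).
Qed.
End RingGirth.

(** * Renumbering the vertices and assembling the ring graph *)

Section Relabel.
Variables (V0 V I : finType) (s d : I -> V0) (f : V0 -> V) (g : V -> V0).
Hypotheses (fK : cancel f g) (gK : cancel g f).

Lemma ends_relabel i : ends (f \o s) (f \o d) i = f @: ends s d i.
Proof. by rewrite /ends imsetU !imset_set1. Qed.

Lemma incident_relabel v i : incident (f \o s) (f \o d) v i = incident s d (g v) i.
Proof. by rewrite /incident /= -!(can2_eq gK fK). Qed.

Lemma matching_bits_relabel mu :
  matching_bits (f \o s) (f \o d) mu <-> matching_bits s d mu.
Proof.
split=> H v.
  by rewrite -(H (f v)); apply: eq_bigr => i _; rewrite incident_relabel fK.
by rewrite -(H (g v)); apply: eq_bigr => i _; rewrite incident_relabel.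
Qed.

Lemma inc_graph_relabel x y :
  inc_graph (f \o s) (f \o d) x y = inc_graph s d (g x) (g y).
Proof.
apply: eq_existsb => i; rewrite ends_relabel.
rewrite -{1}(gK x) -{1}(gK y) -!imset_set1 -imsetU.
by rewrite (inj_eq (imset_inj (can_inj fK))).
Qed.
End Relabel.

Lemma ring_graph_exists m (tau : 'I_m -> bool) : 1 < m ->
  exists e : rel 'I_(m * 18),
    simple_graph e /\ cubic e /\ cyclically_k_connected e 4 /\ girth_eq e 5 /\
    m3 e = ((m * 27 - 3 * \sum_i tau i)%:R / (m * 27)%:R)%R.
Proof.
move=> m1.
have cardV : m * 18 = #|{: 'I_m * 'I_18}| by rewrite card_prod !card_ord.
pose f (v : 'I_m * 'I_18) := cast_ord (esym cardV) (enum_rank v).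
pose g (v : 'I_(m * 18)) : 'I_m * 'I_18 := enum_val (cast_ord cardV v).
have fK : cancel f g by move=> v; rewrite /f /g cast_ordKV enum_rankK.
have gK : cancel g f by move=> v; rewrite /f /g enum_valK cast_ordK.
pose s := f \o ring_src tau; pose d := f \o ring_dst tau.
have f_inj := can_inj fK.
have loop x : s x != d x by rewrite /s /d /= (inj_eq f_inj) ring_loopless.
have endsI : injective (ends s d).
  move=> x y; rewrite !ends_relabel => /(imset_inj f_inj); exact: ring_ends_inj.
have adjE x y : inc_graph s d x y = inc_graph (ring_src tau) (ring_dst tau) (g x) (g y).
  exact: inc_graph_relabel.
exists (inc_graph s d); split; [|split; [|split; [|split]]].
- by split; [apply: inc_graph_sym | apply: inc_graph_irr].
- apply: inc_graph_cubic => // v; apply: etrans (ring_degree tau (g v)).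
  by apply: eq_bigr => x _; apply: incident_relabel.
- apply: inc_graph_cyclically_4_connected => // X cutX.
  case: (@ring_cut m tau m1 (X \o f)) => // -[a aP]; [left|right];
  by exists (f a) => v Xv; rewrite -(gK v) (aP (g v)) //= gK.
- apply: inc_graph_girth5 => [x y z|x y z w|].
  + by rewrite !adjE; apply: ring_no_triangle.
  + rewrite !adjE => xy yz zw wx xz yw.
    by apply: (ring_no_square m1 xy yz zw wx); rewrite (inj_eq (can_inj gK)).
  have [a [b [c [h [k [u ab bc ch /andP [hk ka]]]]]]] := ring_pentagon tau m1.
  exists (map f [:: a; b; c; h; k]); split=> //.
  by rewrite /is_cycle map_inj_uniq // u /= !adjE !fK ab bc ch hk ka.
have -> : m * 27 = #|{: 'I_m * 'I_27}| by rewrite card_prod !card_ord.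
apply: inc_graph_m3 => //.
  move=> mu1 mu2 mu3 c1 c2 c3.
  by apply: (@ring_uncovered_ge m tau); apply/(matching_bits_relabel _ _ fK gK).
exists (ring_matching tau 0), (ring_matching tau 1), (ring_matching tau 2).
split; [..|exact: uncovered_ring_matching];
  by apply/(matching_bits_relabel _ _ fK gK)/ring_matchingP.
Qed.

(** * Choice of the parameters *)

Local Open Scope ring_scope.

Unset Implicit Arguments.

(* "infinitely many" graphs: for every bound n there is such a graph with
   more than n vertices (vertex set 'I_N). *)
Theorem theorem2 (r : rat) :
  9%:R / 10%:R <= r -> r < 1 ->
  forall n : nat, exists (N : nat) (e : rel 'I_N),
    (n < N)%N /\ simple_graph e /\ cubic e /\
    cyclically_k_connected e 4 /\ girth_eq e 5 /\ m3 e = r.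
Proof.
(* The bound [9 * a <= b] follows from [1 - r <= 1/10]; it will give [k <= m]. *)
move=> r9 r1 n; have [a [b [b0 ab rE]]] : exists a b : nat,
    [/\ (0 < b)%N, (9 * a <= b)%N & r = 1 - a%:R / b%:R].
  pose q := 1 - r; have q0 : 0 <= q by rewrite /q; lra.
  exists `|numq q|%N, `|denq q|%N.
  have qE : q = `|numq q|%N%:R / `|denq q|%N%:R.
    by rewrite !natr_absz !ger0_norm ?numq_ge0 ?denq_ge0 // divq_num_den.
  have d0 : (0 < `|denq q|)%N by rewrite absz_gt0 denq_neq0.
  split=> //; last by rewrite -qE /q; lra.
  have d0r : (0 : rat) < `|denq q|%N%:R by rewrite ltr0n.
  rewrite -(ler_nat rat) natrM.
  have <- : q * `|denq q|%N%:R = `|numq q|%N%:R by rewrite {1}qE mulfVK // gt_eqF.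
  by rewrite mulrA ler_piMl ?ler0n // /q; lra.
(* With the first [k] of [m] blocks of type [true], the missed fraction [k / 9m] is [a / b]. The
   factor [n.+2] makes [m] exceed both 1 and [n]. *)
pose m := (b * n.+2)%N; pose k := (9 * a * n.+2)%N.
have nm : (n.+2 <= m)%N by rewrite leq_pmull.
have m1 : (1 < m)%N by apply: leq_trans nm.
have [e [eS [eC [e4 [e5 e3]]]]] := ring_graph_exists (fun i : 'I_m => (i < k)%N) m1.
exists (m * 18)%N, e; split.
  by apply: leq_trans (_ : m <= _)%N; [apply: leq_trans nm | rewrite leq_pmulr].
do 4 split => //; rewrite e3 rE.
have -> : (\sum_(i < m) (i < k)%N = k)%N.
  have km : (k <= m)%N by rewrite /k /m leq_mul2r ab orbT.
  have -> : (\sum_(i < m) (i < k)%N = \sum_(i < m | (i < k)%N) 1)%N.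
    by rewrite [RHS]big_mkcond; apply: eq_bigr => i _; case: ifP.
  by rewrite -(big_ord_widen _ (fun=> 1%N)) // sum1_card card_ord.
have a_le_b : (a <= b)%N by apply: leq_trans ab; rewrite leq_pmull.
have -> : (m * 27 = 27 * n.+2 * b)%N by rewrite /m; ring.
have -> : (3 * k = 27 * n.+2 * a)%N by rewrite /k; ring.
rewrite -mulnBr.
rewrite natrM [X in _ / X]natrM natrB //.
have nz : ((27 * n.+2)%N%:R : rat) != 0 by rewrite pnatr_eq0.
have bz : (b%:R : rat) != 0 by rewrite pnatr_eq0 -lt0n.
by rewrite -mulf_div divff // mul1r mulrBl divff.
Qed.
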